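(* For all integers $N\ge1$, $\mathrm{ospt}(N+1)\ge\mathrm{ospt}(N)$.
   Context: For a partition $\lambda$, $\mathrm{rank}(\lambda)$ is the largest part of $\lambda$ minus the number of parts of $\lambda$. Let $o(\lambda)$ be the number of ones in $\lambda$ and $\mu(\lambda)$ the number of parts strictly larger than $o(\lambda)$; $\mathrm{crank}(\lambda)$ is the largest part of $\lambda$ if $o(\lambda)=0$, and $\mu(\lambda)-o(\lambda)$ if $o(\lambda)>0$. $M(m,N)$ (resp. $N(m,N)$) is the number of partitions of $N$ with crank (resp. rank) $m$, with the convention that for $N=1$ one sets $M(0,1)=-1$, $M(1,1)=M(-1,1)=1$ and $M(m,1)=0$ otherwise. Set $M_1^+(N):=\sum_{m\ge1}m\,M(m,N)$, $N_1^+(N):=\sum_{m\ge1}m\,N(m,N)$, and $\mathrm{ospt}(N):=M_1^+(N)-N_1^+(N)$. *)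

(* Defs.v *)
From mathcomp Require Import all_boot all_order all_algebra.

Set Implicit Arguments.
Unset Strict Implicit.
Unset Printing Implicit Defensive.

Import Order.TTheory GRing.Theory Num.Theory.

Definition is_partition (N : nat) (la : seq nat) : bool :=
  [&& sorted geq la, all (fun i => 0 < i) la & sumn la == N].

Definition largest_part (la : seq nat) : nat := \max_(i <- la) i.

Definition rank (la : seq nat) : int :=
  ((largest_part la)%:Z - (size la)%:Z)%R.

Definition num_ones (la : seq nat) : nat := count_mem 1 la.

Definition mu (la : seq nat) : nat := count (fun i => num_ones la < i) la.

Definition crank (la : seq nat) : int :=
  if num_ones la == 0 then ((largest_part la)%:Z)%R
  else ((mu la)%:Z - (num_ones la)%:Z)%R.

(* A partition of N has at most N parts, each at most N, so all of them occur
   among the sequences of length at most N over {0, ..., N}; see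
   [partitionsP]. *)
Definition parts (N : nat) (s : N.-bseq 'I_N.+1) : seq nat :=
  [seq val i | i <- s].

Definition partitions (N : nat) : {set N.-bseq 'I_N.+1} :=
  [set s | is_partition N (parts s)].

Definition rank_count (m : int) (N : nat) : int :=
  (#|[set s in partitions N | rank (parts s) == m]|%:Z)%R.

(* At N = 1 the values are those of the usual crank generating function
   rather than the actual counts. *)
Definition crank_count (m : int) (N : nat) : int :=
  if N == 1 then
    (if m == 0 then -1 else if (m == 1) || (m == -1) then 1 else 0)%R
  else (#|[set s in partitions N | crank (parts s) == m]|%:Z)%R.

(* The sums over all m >= 1 stop at m = N: the terms with m > N vanish
   ([rank_count_gt], [crank_count_gt]). *)
Definition M1plus (N : nat) : int :=
  (\sum_(1 <= m < N.+1) m%:Z * crank_count m%:Z N)%R.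

Definition N1plus (N : nat) : int :=
  (\sum_(1 <= m < N.+1) m%:Z * rank_count m%:Z N)%R.

Definition ospt (N : nat) : int := (M1plus N - N1plus N)%R.

Lemma parts_inj (N : nat) : injective (@parts N).
Proof. by move=> s t /(inj_map val_inj) /val_inj. Qed.

Lemma mem_leq_sumn (la : seq nat) (i : nat) : i \in la -> i <= sumn la.
Proof.
elim: la => //= a la IH; rewrite inE => /orP[/eqP->|/IH h].
  exact: leq_addr.
exact: leq_trans h (leq_addl _ _).
Qed.

Lemma size_leq_sumn (la : seq nat) :
  all (fun i => 0 < i) la -> size la <= sumn la.
Proof. by elim: la => //= a la IH /andP[a0 /IH h]; rewrite -add1n leq_add. Qed.

Lemma partitionsP (N : nat) (la : seq nat) :
  reflect (exists2 s, s \in partitions N & parts s = la) (is_partition N la).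
Proof.
apply: (iffP idP) => [Hla|[s + <-]]; last by rewrite inE.
have /and3P[_ pos /eqP sumE] := Hla.
have szla : size [seq inord i : 'I_N.+1 | i <- la] <= N.
  by rewrite size_map -[leqRHS]sumE size_leq_sumn.
have partsE : parts (Bseq szla) = la.
  rewrite /parts /= -map_comp -[RHS]map_id; apply/eq_in_map => i ila /=.
  by rewrite inordK // ltnS -[leqRHS]sumE mem_leq_sumn.
by exists (Bseq szla); rewrite ?inE partsE.
Qed.

Lemma largest_part_leq (N : nat) (la : seq nat) :
  is_partition N la -> largest_part la <= N.
Proof.
case/and3P=> _ _ /eqP <-; rewrite /largest_part.
by apply/bigmax_leqP_seq => i ila _; exact: mem_leq_sumn.
Qed.

Lemma rank_count_gt (m N : nat) : N < m -> rank_count m%:Z%R N = 0%R.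
Proof.
move=> Nm; rewrite /rank_count; apply/eqP; rewrite eqz_nat cards_eq0.
apply/eqP/setP => s; rewrite !inE; apply/negP => /andP[Hs /eqP rE].
have : (rank (parts s) <= N%:Z)%R.
  rewrite /rank lerBlDr -PoszD lez_nat.
  exact: leq_trans (largest_part_leq Hs) (leq_addr _ _).
by rewrite rE lez_nat leqNgt Nm.
Qed.

Lemma crank_count_gt (m N : nat) : 0 < N -> N < m -> crank_count m%:Z%R N = 0%R.
Proof.
move=> N0 Nm; rewrite /crank_count; case: eqP => [N1|_].
  by rewrite N1 in Nm; case: m Nm => [|[|m]].
apply/eqP; rewrite eqz_nat cards_eq0.
apply/eqP/setP => s; rewrite !inE; apply/negP => /andP[Hs /eqP rE].
have : (crank (parts s) <= N%:Z)%R.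
  rewrite /crank; case: ifP => _; first by rewrite lez_nat largest_part_leq.
  rewrite lerBlDr -PoszD lez_nat.
  apply: leq_trans (count_size _ _) _; case/and3P: Hs => _ pos /eqP sumE.
  by apply: leq_trans (size_leq_sumn pos) _; rewrite sumE leq_addr.
by rewrite rE lez_nat leqNgt Nm.
Qed.

(* Main.v *)
(* Write P for the generating function of partitions and (q)_t for the product
   of the 1 - q^k, 1 <= k <= t.  Counting the partitions with rank at least m
   once by largest part and once by number of parts gives Dyson's recursion
     G_m = q^(m+1) (P - G_(m+3)),
   and the number of ones yields, for the partitions of crank exactly m,
     M_m = (1 - q) q^m d_m,  d_m = sum_s q^(s^2 + (m+2)s) / ((q)_s (q)_(m+s)),
   whose contiguous relation in m implies C_m = q^m (P - C_(m+1)) for crank at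
   least m.  Unfolding both recursions, the generating function of ospt is
     P * sum_(n >= 1) (-1)^(n-1) sum_(0 <= k < n) q^(n(n+1)/2 + kn).
   Following Andrews, Chan and Kim, the double sum regroups into blocks with
   factors (1 - q^a)(1 - q^b).  Multiplied by (1 - q) P these blocks have
   nonnegative coefficients because 1, a, b are distinct, except in the row
   i = 0, where a = 1 occurs: there (1 - q)^2 (1 - q^(2c)) P is 1 - q plus
   nonnegative terms, and the isolated negative terms are absorbed by the very
   first block. *)

Require Import Defs.
From mathcomp Require Import all_boot all_order all_algebra.
From mathcomp Require Import zify ring.

Set Implicit Arguments.
Unset Strict Implicit.
Unset Printing Implicit Defensive.

Import Order.TTheory GRing.Theory Num.Theory.

(** * Partitions as lists, counted under a bound on their parts *)

Definition partition_seq (N : nat) : seq (seq nat) :=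
  [seq parts s | s <- enum (partitions N)].

Lemma mem_partition_seq (N : nat) (l : seq nat) :
  (l \in partition_seq N) = is_partition N l.
Proof.
apply/mapP/partitionsP => -[s]; first by rewrite mem_enum; exists s.
by move=> sN <-; exists s; rewrite ?mem_enum.
Qed.

Lemma partition_seq_uniq (N : nat) : uniq (partition_seq N).
Proof. by rewrite map_inj_uniq ?enum_uniq //; exact: parts_inj. Qed.

Lemma card_partitions (N : nat) (Q : pred (seq nat)) :
  #|[set s in partitions N | Q (parts s)]| = count Q (partition_seq N).
Proof.
rewrite count_map -size_filter cardE; apply/perm_size/uniq_perm.
- exact: enum_uniq.
- exact/filter_uniq/enum_uniq.
- by move=> s; rewrite mem_enum [LHS]inE [RHS]mem_filter mem_enum andbC.
Qed.

Definition bounded_count (a : nat) (Q : pred (seq nat)) (N : nat) : nat :=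
  count (fun l => all (geq a) l && Q l) (partition_seq N).

Lemma is_partition_cons (a N : nat) (l : seq nat) :
  is_partition N (a :: l) =
  [&& 0 < a, a <= N, is_partition (N - a) l & all (geq a) l].
Proof.
have sE : sorted geq (a :: l) = all (geq a) l && sorted geq l.
  by rewrite /= path_sortedE // => x y z /= xy yz; exact: leq_trans yz xy.
rewrite /is_partition sE /=; have [aN|Na] := leqP a N; last first.
  rewrite andbF; apply/negP => /and3P[_ _ /eqP E].
  by move: Na; rewrite -E ltnNge leq_addr.
rewrite -{1}(subnKC aN) eqn_add2l.
by case: (0 < a); case: all; case: sorted; case: all; case: (_ == _).
Qed.

Lemma count_split (T : Type) (P S : pred T) (s : seq T) :
  count P s = count (fun x => P x && ~~ S x) s + count (fun x => P x && S x) s.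
Proof. by rewrite -!sum1_count (bigID S) addnC. Qed.

(** Being sorted, a partition with parts at most a + 1 either avoids a + 1 or starts with it.
    Deleting that head keeps the bound a + 1 but lowers the size. *)
Lemma bounded_countS (a : nat) (Q : pred (seq nat)) (N : nat) :
  bounded_count a.+1 Q N = bounded_count a Q N +
  (if a < N then bounded_count a.+1 (fun l => Q (a.+1 :: l)) (N - a.+1) else 0).
Proof.
rewrite /bounded_count (count_split _ (fun l => head 0 l == a.+1)).
congr (_ + _).
  apply: eq_in_count => -[_|b l]; first by rewrite andbT.
  rewrite mem_partition_seq is_partition_cons => /and4P[_ _ _ lb] /=.
  rewrite andbAC; congr (_ && _).
  case: (ltngtP b a.+1) => [ba|ba|->] /=.
  - rewrite -ltnS ba andbT (sub_all _ lb) ?(sub_all _ lb) //= => x /= xb; lia.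
  - by rewrite leqNgt (ltnW ba).
  - by rewrite andbF ltnn.
case: ltnP => aN; last first.
  apply/eqP; rewrite -leqn0 leqNgt -has_count; apply/hasPn => -[|b l]; first by rewrite andbF.
  rewrite mem_partition_seq is_partition_cons => /and4P[_ bN _ _] /=.
  by rewrite andbC; case: eqP => // E; move: bN; rewrite E leqNgt ltnS aN.
rewrite -size_filter -[RHS]size_filter -[RHS](size_map (cons a.+1)).
apply/perm_size/uniq_perm.
- by rewrite filter_uniq ?partition_seq_uniq.
- rewrite map_inj_uniq => [|x y []//]; by rewrite filter_uniq ?partition_seq_uniq.
move=> [|b l]; rewrite mem_filter /=; first by rewrite andbF; apply/esym/mapP => -[].
rewrite mem_partition_seq is_partition_cons.
apply/idP/mapP => [/andP[/andP[/andP[/andP[_ la] Ql] /eqP bE] /and4P[_ _ pl _]]|].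
  rewrite bE in la Ql pl *; exists l => //.
  by rewrite mem_filter mem_partition_seq /= la Ql.
case=> l' + [-> ->]; rewrite mem_filter mem_partition_seq => /andP[/andP[la Ql] pl].
by rewrite leqnn la Ql eqxx aN pl.
Qed.

Lemma bounded_count0 (Q : pred (seq nat)) (N : nat) :
  bounded_count 0 Q N = (N == 0) && Q [::].
Proof.
rewrite /bounded_count -(eq_in_count (a1 := fun l => (l == [::]) && Q [::])).
  rewrite (eq_count (a2 := fun l => Q [::] && pred1 [::] l)) => [|l];
    last by rewrite andbC.
  case: (Q [::]); last by rewrite andbF count_pred0.
  rewrite andbT count_uniq_mem ?partition_seq_uniq // mem_partition_seq.
  by rewrite /is_partition /= eq_sym.
move=> [|b l] //; rewrite mem_partition_seq is_partition_cons => /and4P[b0 _ _ _] /=.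
by rewrite leqNgt b0.
Qed.

Lemma bounded_count_large (a N : nat) (Q : pred (seq nat)) :
  N <= a -> bounded_count a Q N = count Q (partition_seq N).
Proof.
move=> Na; apply: eq_in_count => l; rewrite mem_partition_seq.
case/and3P=> _ _ /eqP lN; rewrite (introT allP _) //= => i /mem_leq_sumn.
by rewrite lN /= => iN; exact: leq_trans Na.
Qed.

(** * Generating functions truncated at order K *)

(* A nilpotent q makes every power series in q a finite sum, and 1 - q^k
   invertible for k > 0; the instance of interest is q = X in Z[X]/(X^K). *)
Section NilpotentSeries.

Variables (R : comNzRingType) (q : R) (K : nat).
Hypothesis qK : (q ^+ K = 0)%R.

Local Open Scope ring_scope.

Lemma q_ge (n : nat) : (K <= n)%N -> q ^+ n = 0.
Proof. by move=> Kn; rewrite -(subnK Kn) exprD qK mulr0. Qed.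

Lemma K_gt0 : (0 < K)%N.
Proof.
by rewrite lt0n; apply/eqP => K0; move/eqP: qK; rewrite K0 expr0 oner_eq0.
Qed.

(** The hypothesis says that x - y is fixed by multiplication by q^(a+1). Iterating K times makes it
    a multiple of q^K, hence zero. *)
Lemma mul_1Bq_inj (a : nat) (x y : R) :
  (1 - q ^+ a.+1) * x = (1 - q ^+ a.+1) * y -> x = y.
Proof.
move=> E; apply/eqP; rewrite -subr_eq0; apply/eqP.
have {}E : x - y = q ^+ a.+1 * (x - y).
  apply/eqP; rewrite -subr_eq0; apply/eqP.
  have -> : x - y - q ^+ a.+1 * (x - y)
          = (1 - q ^+ a.+1) * x - (1 - q ^+ a.+1) * y by ring.
  by rewrite E subrr.
have {}E n : x - y = q ^+ (a.+1 * n) * (x - y).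
  elim: n => [|n IH]; first by rewrite muln0 expr0 mul1r.
  by rewrite {1}IH {1}E mulrA -exprD mulnS addnC.
by rewrite (E K) q_ge ?mul0r // leq_pmull.
Qed.

Definition gf (f : nat -> int) : R := \sum_(0 <= n < K) q ^+ n *~ f n.

Lemma eq_gf (f g : nat -> int) :
  (forall n, (n < K)%N -> f n = g n) -> gf f = gf g.
Proof. by move=> fg; apply: eq_big_nat => n /fg->. Qed.

Lemma gfD (f g : nat -> int) : gf (fun n => f n + g n) = gf f + gf g.
Proof. by rewrite -big_split; apply: eq_bigr => n _; rewrite mulrzDr. Qed.

Lemma gfB (f g : nat -> int) : gf (fun n => f n - g n) = gf f - gf g.
Proof. by rewrite -sumrB; apply: eq_bigr => n _; rewrite mulrzBr. Qed.

Lemma gf_sum (I : Type) (r : seq I) (P : pred I) (F : I -> nat -> int) :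
  gf (fun n => \sum_(i <- r | P i) F i n) = \sum_(i <- r | P i) gf (F i).
Proof.
rewrite exchange_big; apply: eq_bigr => n _ /=.
by rewrite mulrz_sumr.
Qed.

Lemma gfM (c : int) (f : nat -> int) : gf (fun n => c * f n) = gf f *~ c.
Proof.
by rewrite mulrz_suml; apply: eq_bigr => n _; rewrite -mulrzA mulrC.
Qed.

Lemma gf_shift (a : nat) (f : nat -> int) :
  gf (fun n => if (a <= n)%N then f (n - a)%N else 0) = q ^+ a * gf f.
Proof.
rewrite /gf mulr_sumr.
have -> : \sum_(0 <= n < K) q ^+ n *~ (if (a <= n)%N then f (n - a)%N else 0)
  = \sum_(0 <= n < K + a) q ^+ n *~ (if (a <= n)%N then f (n - a)%N else 0).
  rewrite [RHS](@big_cat_nat _ _ _ K) ?leq_addr //= [X in _ + X]big_nat_cond.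
  rewrite [X in _ + X]big1 ?addr0 // => n /andP[/andP[Kn _] _].
  by rewrite q_ge // mul0rz.
rewrite (@big_cat_nat _ _ _ a) ?leq_addl //= [X in X + _]big_nat_cond.
rewrite big1 ?add0r => [|n]; last first.
  by rewrite andbT => /andP[_ na]; rewrite leqNgt na mulr0z.
rewrite -{1}[a]add0n big_addn addnK; apply: eq_bigr => n _.
by rewrite leq_addl addnK addnC exprD mulrzAr.
Qed.

Lemma gf_delta (m : nat) : gf (fun n => (n == m)%:Z) = q ^+ m.
Proof.
have [mK|Km] := ltnP m K; last first.
  rewrite q_ge // /gf big_nat_cond big1 // => n /andP[/andP[_ nK] _].
  by rewrite ltn_eqF ?mulr0z // (leq_trans nK Km).
rewrite /gf big_mkord (bigD1 (Ordinal mK)) //= eqxx big1 ?addr0 // => n nm.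
by rewrite -val_eqE /= in nm; rewrite (negPf nm).
Qed.

Definition part_gf (a : nat) (Q : pred (seq nat)) : R :=
  gf (fun n => (bounded_count a Q n)%:Z).

Lemma eq_part_gf (a : nat) (Q Q' : pred (seq nat)) :
  (forall l, all (geq a) l -> Q l = Q' l) -> part_gf a Q = part_gf a Q'.
Proof.
move=> QQ'; apply: eq_gf => n _; congr (_%:Z); apply: eq_count => l.
by case la: (all _ l) => //=; rewrite QQ'.
Qed.

Lemma part_gf_split (a : nat) (Q S : pred (seq nat)) :
  part_gf a Q =
  part_gf a (fun l => Q l && ~~ S l) + part_gf a (fun l => Q l && S l).
Proof.
rewrite -gfD; apply: eq_gf => n _; rewrite -PoszD; congr (_%:Z).
by rewrite {1}/bounded_count (count_split _ S); congr addn;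
  apply: eq_count => l; rewrite andbA.
Qed.

Lemma part_gf_pred0 (a : nat) (Q : pred (seq nat)) :
  (forall l, all (geq a) l -> Q l = false) -> part_gf a Q = 0.
Proof.
move=> Q0; rewrite (eq_part_gf Q0); apply: big1 => n _.
rewrite /bounded_count (eq_count (a2 := pred0)) ?count_pred0 //.
by move=> l; rewrite andbF.
Qed.

Lemma part_gfS (a : nat) (Q : pred (seq nat)) :
  part_gf a.+1 Q =
  part_gf a Q + q ^+ a.+1 * part_gf a.+1 (fun l => Q (a.+1 :: l)).
Proof.
rewrite -gf_shift -gfD; apply: eq_gf => n _.
by rewrite bounded_countS; case: ifP => _; rewrite ?PoszD ?addr0.
Qed.

Lemma part_gf0 (Q : pred (seq nat)) : part_gf 0 Q = (Q [::])%:R.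
Proof.
have -> : (Q [::])%:R = q ^+ 0 *~ (Q [::])%:Z by rewrite expr0.
rewrite -gf_delta -gfM.
apply: eq_gf => n _; rewrite bounded_count0.
by case: (Q [::]); rewrite ?andbT ?andbF ?mul1r ?mul0r.
Qed.

(** Sizes n < K involve only parts below K, so all bounds from K - 1 on give the same series. Later
    proofs switch freely between such bounds. *)
Lemma part_gf_large (a : nat) (Q : pred (seq nat)) : (K <= a.+1)%N ->
  part_gf a Q = gf (fun n => (count Q (partition_seq n))%:Z).
Proof.
by move=> Ka; apply: eq_gf => n nK; rewrite bounded_count_large // -ltnS (leq_trans nK).
Qed.

Lemma part_gf_bound (a b : nat) (Q : pred (seq nat)) : (K <= a.+1)%N ->
  part_gf a (fun l => all (geq b) l && Q l) = part_gf b Q.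
Proof. by move=> Ka; rewrite part_gf_large. Qed.

Lemma part_gf_fibers (a : nat) (st : seq nat -> nat) (Q : pred (seq nat)) :
  (forall n l, is_partition n l -> (st l <= n)%N) ->
  part_gf a Q = \sum_(0 <= s < K) part_gf a (fun l => Q l && (st l == s)).
Proof.
move=> st_le; rewrite -gf_sum; apply: eq_gf => n nK.
rewrite -(big_morph Posz PoszD (erefl _)); congr (_%:Z).
under eq_bigr => s _ do rewrite /bounded_count -sum1_count.
rewrite (exchange_big_dep (fun l => all (geq a) l && Q l)) /=; last first.
  by move=> s l _; rewrite andbA => /andP[].
rewrite /bounded_count -sum1_count big_seq_cond [RHS]big_seq_cond.
apply: eq_bigr => l /andP[]; rewrite mem_partition_seq => /st_le st_n lQ.
rewrite (eq_bigl (pred1 (st l))) => [|s]; last by rewrite andbA lQ eq_sym.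
by rewrite big_nat1_eq /= (leq_ltn_trans st_n nK).
Qed.

(** * The rank *)

Definition box_gf (a t : nat) : R := part_gf a (fun l => size l <= t)%N.
Definition exact_gf (a t : nat) : R := part_gf a (fun l => size l == t).

Lemma box_gf0r (a : nat) : box_gf a 0 = 1.
Proof.
elim: a => [|a IH]; rewrite /box_gf; first by rewrite part_gf0.
by rewrite part_gfS -/(box_gf a 0) IH part_gf_pred0 ?mulr0 ?addr0.
Qed.

Lemma box_gfSS (a t : nat) :
  box_gf a.+1 t.+1 = box_gf a t.+1 + q ^+ a.+1 * box_gf a.+1 t.
Proof. by rewrite /box_gf part_gfS. Qed.

Lemma exact_gf0r (a : nat) : exact_gf a 0 = 1.
Proof.
rewrite -(box_gf0r a); apply: eq_part_gf => l _; by rewrite leqn0.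
Qed.

Lemma exact_gfSS (a t : nat) :
  exact_gf a.+1 t.+1 = exact_gf a t.+1 + q ^+ a.+1 * exact_gf a.+1 t.
Proof. by rewrite /exact_gf part_gfS. Qed.

(** Subtracting one from each of the t parts leaves at most t parts, each at most a. The proof
    checks this through the recursions in a and t. *)
Lemma exact_gfS (a t : nat) : exact_gf a.+1 t = q ^+ t * box_gf a t.
Proof.
elim: a t => [|a IH].
  elim=> [|t IH]; first by rewrite exact_gf0r box_gf0r mulr1.
  rewrite exact_gfSS IH /exact_gf /box_gf !part_gf0 /= add0r mulrA -exprS.
  by [].
elim=> [|t IHt]; first by rewrite exact_gf0r box_gf0r mulr1.
by rewrite exact_gfSS IHt IH box_gfSS !exprS; ring.
Qed.

Lemma box_gfSr (a t : nat) : box_gf a t.+1 = box_gf a t + exact_gf a t.+1.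
Proof.
rewrite /box_gf (part_gf_split _ _ (fun l => size l == t.+1)); congr (_ + _).
  by apply: eq_part_gf => l _; rewrite andbC -ltn_neqAle ltnS.
by apply: eq_part_gf => l _; case: eqP => [->|]; rewrite ?leqnn ?andbF.
Qed.

(* 1 / (q)_t: a partition of n < K has all its parts at most K. *)
Definition inv_poch (t : nat) : R := box_gf K t.

Lemma inv_poch0 : inv_poch 0 = 1. Proof. exact: box_gf0r. Qed.

Lemma exact_gf_large (t : nat) : exact_gf K t = q ^+ t * inv_poch t.
Proof. by rewrite -exact_gfS /exact_gf !part_gf_large // (leq_trans _ (leqnSn _)). Qed.

Lemma inv_pochS (t : nat) : (1 - q ^+ t.+1) * inv_poch t.+1 = inv_poch t.
Proof.
by rewrite mulrBl mul1r -exact_gf_large /inv_poch box_gfSr addrK.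
Qed.

Definition all_gf : R := gf (fun n => (size (partition_seq n))%:Z).

Lemma inv_poch_large (t : nat) : (K <= t.+1)%N -> inv_poch t = all_gf.
Proof.
move=> Kt; rewrite /inv_poch /box_gf part_gf_large //; apply: eq_gf => n nK.
congr (_%:Z); apply/eqP; rewrite -all_count; apply/allP => l.
rewrite mem_partition_seq => /and3P[_ /size_leq_sumn + /eqP lN].
by rewrite lN -ltnS => ln; rewrite -ltnS (leq_trans _ Kt) // (leq_ltn_trans _ nK).
Qed.

Lemma largest_part_le (b : nat) (l : seq nat) :
  (largest_part l <= b)%N = all (geq b) l.
Proof.
by apply/bigmax_leqP_seq/allP => lb i /lb; [apply | move=> ib _].
Qed.

Lemma largest_part_cons (a : nat) (l : seq nat) :
  all (geq a) l -> largest_part (a :: l) = a.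
Proof.
by move=> la; rewrite /largest_part big_cons; apply/maxn_idPl; rewrite largest_part_le.
Qed.

(** Here b is the largest part: the rank condition allows b - m parts, one of which is b itself.
    Positivity of m excludes the empty partition, of rank 0. *)
Lemma rank_ge_box (a m : nat) : (0 < m)%N ->
  part_gf a (fun l => m%:Z <= rank l) =
  \sum_(m.+1 <= b < a.+1) q ^+ b * box_gf b (b - m.+1).
Proof.
move=> m0; elim: a => [|a IH].
  rewrite part_gf0 big_geq // /rank /largest_part big_nil subr0.
  by case: m m0.
rewrite part_gfS IH; have [ma|am] := leqP m a.
  rewrite [RHS]big_nat_recr //=; congr (_ + _ * _); apply: eq_part_gf => l la.
  by rewrite /rank largest_part_cons //=; apply/idP/idP; lia.
rewrite !big_geq ?ltnS // ?(ltnW am) // part_gf_pred0 ?mulr0 ?addr0 // => l la.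
by rewrite /rank largest_part_cons //=; apply/idP; lia.
Qed.

Definition rank_ge_gf (m : nat) : R :=
  gf (fun n => (count (fun l => m%:Z <= rank l) (partition_seq n))%:Z).

(* The sums over the largest part b on the left, and over the number s of parts
   of the partitions of rank at most m + 2 on the right, agree term by term for
   b = s + m + 1. *)
Lemma rank_ge_gf_rec (m : nat) : (0 < m)%N ->
  rank_ge_gf m = q ^+ m.+1 * (all_gf - rank_ge_gf m.+3).
Proof.
move=> m0; have KK : (K <= K.+1)%N by [].
have -> : all_gf - rank_ge_gf m.+3 = part_gf K (fun l => ~~ (m.+3%:Z <= rank l)).
  rewrite part_gf_large // -gfB; apply: eq_gf => n _.
  rewrite -(count_predC (fun l => m.+3%:Z <= rank l) (partition_seq n)) PoszD.
  by rewrite addrAC subrr add0r.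
have -> : rank_ge_gf m = part_gf (m + K) (fun l => m%:Z <= rank l).
  by rewrite part_gf_large // ltnW // ltnS leq_addl.
rewrite rank_ge_box // (big_addn 0 _ m.+1 xpredT).
have -> : ((m + K).+1 - m.+1 = K)%N by rewrite subSS addnC addnK.
rewrite (part_gf_fibers _ _ (st := size)).
  rewrite mulr_sumr; apply: eq_bigr => s _; rewrite addnK exprD mulrAC mulrC.
  congr (_ * _); rewrite -exact_gfS /exact_gf -(part_gf_bound (a := K)) //.
  apply: eq_part_gf => l _; rewrite -largest_part_le /rank.
  by apply/idP/idP; lia.
by move=> n l /and3P[_ /size_leq_sumn + /eqP <-].
Qed.

(** * The crank *)

Lemma ones_gf (j : nat) : part_gf 1 (fun l => num_ones l == j) = q ^+ j.
Proof.
elim: j => [|j IH]; rewrite part_gfS part_gf0 /=.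
  by rewrite part_gf_pred0 ?mulr0 ?addr0.
by rewrite add0r [RHS]exprS -IH.
Qed.

(** Fixing the number of ones replaces the factor 1/(1 - q) by q^j. Here [inv_poch] has to count by
    a bound on the parts rather than on their number; the induction, which clears the factor 1 -
    q^(a+2), takes the place of conjugation. *)
Lemma num_ones_gf (a j : nat) :
  part_gf a.+1 (fun l => num_ones l == j) = q ^+ j * ((1 - q) * inv_poch a.+1).
Proof.
elim: a => [|a IH].
  by have := inv_pochS 0; rewrite ones_gf expr1 inv_poch0 => ->; rewrite mulr1.
apply: (@mul_1Bq_inj a.+1); rewrite mulrCA [X in _ = _ * X]mulrCA inv_pochS -IH.
by rewrite mulrBl mul1r {1}part_gfS addrK.
Qed.

(** The t parts above s, lowered by s each, form a partition into exactly t parts at most c. The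
    parts up to s, including the s ones, are independent of them. *)
Lemma num_ones_mu_gf (s c t : nat) : (0 < s)%N ->
  part_gf (s + c) (fun l => (num_ones l == s) && (count (ltn s) l == t)) =
  q ^+ (s * t) * exact_gf c t * (q ^+ s * ((1 - q) * inv_poch s)).
Proof.
case: s => // s _; elim: c t => [|c IH] t.
  rewrite addn0 -num_ones_gf.
  have s0 l : all (geq s.+1) l -> count (ltn s.+1) l = 0%N.
    move=> /allP ls; apply/eqP; rewrite -leqn0 leqNgt -has_count -all_predC.
    by apply/allP => i /ls /=; rewrite -leqNgt.
  case: t => [|t].
    rewrite muln0 expr0 exact_gf0r !mul1r; apply: eq_part_gf => l /s0 ->.
    by rewrite andbT.
  rewrite /exact_gf part_gf0 mulr0 mul0r part_gf_pred0 // => l /s0 ->.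
  by rewrite andbF.
elim: t => [|t IHt]; rewrite addnS part_gfS IH.
  rewrite !exact_gf0r part_gf_pred0 ?mulr0 ?addr0 // => l _ /=.
  by rewrite ltnS leq_addr andbF.
rewrite exact_gfSS -[part_gf (s.+1 + c).+1 _](_ : part_gf (s.+1 + c.+1) (fun l =>
  (num_ones l == s.+1) && (count (ltn s.+1) l == t)) = _).
  rewrite IHt -addnS exprD mulnS [q ^+ (s.+1 + _)]exprD; ring.
by rewrite addnS; apply: eq_part_gf => l _ /=; rewrite ltnS leq_addr.
Qed.

Lemma crank_partition1 (l : seq nat) : is_partition 1 l -> crank l = -1.
Proof.
case: l => // a l; rewrite is_partition_cons => /and4P[a0 a1].
have -> : a = 1%N by apply/eqP; rewrite eqn_leq a1.
case: l => // b l; rewrite is_partition_cons subnn => /and4P[b0 + _ _].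
by rewrite leqNgt b0.
Qed.

Definition crank_gf (m : nat) : R := gf (crank_count m%:Z).

(* The extra q at m = 1 is the conventional value M(1,1) = 1; it is what makes
   [no_ones_largest_gf] uniform in m. *)
Lemma crank_gf_part (m : nat) : (0 < m)%N ->
  crank_gf m = part_gf K (fun l => crank l == m%:Z) + (m == 1)%:R * q.
Proof.
move=> m0; have -> : (m == 1%N)%:R * q = gf (fun n => (m == 1%N)%:Z * (n == 1%N)%:Z).
  by rewrite gfM gf_delta expr1; case: eqP; rewrite ?mul1r ?mul0r.
rewrite part_gf_large // -gfD; apply: eq_gf => n _; rewrite /crank_count.
have [->|_] := n =P 1%N; last first.
  by rewrite mulr0 addr0 (card_partitions _ (fun l => crank l == m%:Z)).
rewrite (eq_in_count (a2 := pred0)) ?count_pred0 => [|l].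
  by case: m m0 => [|[|m]].
by rewrite mem_partition_seq => /crank_partition1 ->; case: m m0.
Qed.

Definition durfee_gf (m : nat) : R :=
  \sum_(0 <= s < K) q ^+ (s * (m + s) + 2 * s) * (inv_poch s * inv_poch (m + s)).

(** Without ones the crank is the largest part, so the count is a difference between the bounds m +
    1 and m. For m = 0 this difference is 0, and the conventional q supplies the right-hand side,
    which is then q. *)
Lemma no_ones_largest_gf (m : nat) :
  part_gf K (fun l => (crank l == m.+1%:Z) && (num_ones l == 0)) + (m.+1 == 1)%:R * q
  = (1 - q) * q ^+ m.+1 * inv_poch m.+1.
Proof.
have -> : part_gf K (fun l => (crank l == m.+1%:Z) && (num_ones l == 0)) =
    part_gf m.+1 (fun l => num_ones l == 0) - part_gf m (fun l => num_ones l == 0).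
  apply/eqP; rewrite eq_sym subr_eq eq_sym addrC; apply/eqP.
  rewrite -(part_gf_bound (a := K) m.+1) // -(part_gf_bound (a := K) m) //.
  rewrite [RHS](part_gf_split _ _ (fun l => largest_part l == m.+1)).
  congr (_ + _); apply: eq_part_gf => l _; rewrite -!largest_part_le.
    by apply/idP/idP; lia.
  rewrite /crank; have [_|_] := num_ones l =P 0%N; last by rewrite !andbF.
  by rewrite !andbT; apply/idP/idP; lia.
have -> : (1 - q) * q ^+ m.+1 * inv_poch m.+1 =
          (1 - q) * inv_poch m.+1 - (1 - q) * inv_poch m by rewrite -(inv_pochS m); ring.
rewrite num_ones_gf expr0 mul1r; case: m => [|m].
  by rewrite part_gf0 inv_poch0 /=; ring.
by rewrite num_ones_gf expr0 mul1r mul0r addr0.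
Qed.

(** Sum over the number s of ones. For s > 0, crank m means m + s parts above s: the ones give q^s,
    lowering these parts by s gives q^(s(m+s)), and their being exactly m + s in number gives
    q^(m+s). *)
Lemma crank_gf_durfee (m : nat) : (0 < m)%N ->
  crank_gf m = (1 - q) * q ^+ m * durfee_gf m.
Proof.
case: m => // m _; rewrite crank_gf_part // (part_gf_fibers _ _ (st := num_ones)).
  rewrite /durfee_gf (big_ltn K_gt0) [in RHS](big_ltn K_gt0) addrAC no_ones_largest_gf.
  rewrite mulrDr; congr (_ + _).
    by rewrite addn0 expr0 inv_poch0 !mul1r.
  rewrite mulr_sumr; apply: eq_big_nat => s /andP[s0 _].
  have -> : part_gf K (fun l => (crank l == m.+1) && (num_ones l == s)) =
            part_gf (s + K) (fun l => (num_ones l == s) && (count (ltn s) l == m.+1 + s)%N).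
    rewrite !part_gf_large ?leqW ?leq_addl //; apply: eq_gf => n _; congr (_%:Z).
    apply: eq_count => l; rewrite andbC; have [ls|//] := num_ones l =P s.
    rewrite /crank /mu ls gtn_eqF // -/(ltn s); move: (count _ l) => c.
    by apply/idP/idP; lia.
  rewrite num_ones_mu_gf // exact_gf_large.
  have -> : (s * (m.+1 + s) + 2 * s = s * (m.+1 + s) + s + s)%N by lia.
  by rewrite !exprD; ring.
by move=> n l /and3P[_ /size_leq_sumn + /eqP <-]; apply: leq_trans; exact: count_size.
Qed.

(** Over the common factor 1/((q)_s (q)_(m+s+1)), the two terms of index s combine to 1 - q^s. This
    kills s = 0 and lowers (q)_s to (q)_(s-1), so shifting s gives the right-hand side. *)
Lemma durfee_gf_rec (m : nat) :
  durfee_gf m - (1 - q ^+ m.+1) * durfee_gf m.+1 = q ^+ (m + 3) * durfee_gf m.+2.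
Proof.
have -> : durfee_gf m - (1 - q ^+ m.+1) * durfee_gf m.+1 =
  \sum_(0 <= s < K) q ^+ (s * (m + s) + 2 * s) *
    ((1 - q ^+ s) * inv_poch s * inv_poch (m + s).+1).
  rewrite mulr_sumr -sumrB; apply: eq_bigr => s _.
  have -> : (s * (m.+1 + s) + 2 * s = s * (m + s) + 2 * s + s)%N by lia.
  by rewrite addSn -(inv_pochS (m + s)) -addSn !exprD; ring.
rewrite /durfee_gf mulr_sumr; have := K_gt0; case EK : K => [//|k] _.
rewrite big_nat_recl // big_nat_recr // [X in _ = _ + X]mulrA -exprD.
(* After the shift the right-hand sum has one term too many, s = k, whose order is at least K. *)
rewrite [q ^+ (m + 3 + _)]q_ge; last by rewrite EK; nia.
rewrite expr0 subrr !(mul0r, mulr0) add0r addr0; apply: eq_bigr => s _.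
have -> : (s.+1 * (m + s.+1) + 2 * s.+1 = m + 3 + (s * (m.+2 + s) + 2 * s))%N by lia.
by rewrite inv_pochS [RHS]mulrA -exprD (addnS m s) !addSn.
Qed.

Definition crank_ge_gf (m : nat) : R := \sum_(m <= j < K) crank_gf j.

Lemma crank_ge_gfS (m : nat) : (0 < m)%N ->
  crank_ge_gf m = crank_gf m + crank_ge_gf m.+1.
Proof.
move=> m0; rewrite /crank_ge_gf; have [mK|Km] := ltnP m K; first by rewrite big_ltn.
by rewrite crank_gf_durfee // q_ge // !big_geq ?mulr0 ?mul0r ?addr0 // leqW.
Qed.

(** Downward induction on m, with k measuring the distance to K: both sides vanish once m >= K, and
    [durfee_gf_rec] gives the step. *)
Lemma crank_ge_gf_durfee (m : nat) :
  crank_ge_gf m.+1 = q ^+ m.+1 * (durfee_gf m + q ^+ m.+1 * durfee_gf m.+1).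
Proof.
have [k Ek] : exists k, (K <= m + k)%N by exists K; rewrite leq_addl.
elim: k m Ek => [|k IH] m Ek.
  by rewrite q_ge ?mul0r /crank_ge_gf ?big_geq // leqW // -(addn0 m).
rewrite crank_ge_gfS // crank_gf_durfee // IH ?addSnnS //.
have -> : durfee_gf m = q ^+ (m + 3) * durfee_gf m.+2 + (1 - q ^+ m.+1) * durfee_gf m.+1.
  by rewrite -durfee_gf_rec; ring.
by rewrite addnS addn2 !exprS; ring.
Qed.

Lemma durfee_gf_large (m : nat) : (K <= m)%N -> durfee_gf m = all_gf.
Proof.
move=> Km; rewrite /durfee_gf (big_ltn K_gt0) big_nat_cond big1 => [|s].
  by rewrite addr0 addn0 expr0 inv_poch0 !mul1r inv_poch_large // leqW.
by rewrite andbT => /andP[s0 _]; rewrite q_ge ?mul0r //; nia.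
Qed.

(** The same downward induction, now starting from [durfee_gf m = all_gf] for m >= K. It identifies
    the bracket in [crank_ge_gf_durfee] as [all_gf - crank_ge_gf m.+2], which is the crank
    recursion. *)
Lemma durfee_crank_ge (m : nat) :
  durfee_gf m + q ^+ m.+1 * durfee_gf m.+1 + crank_ge_gf m.+2 = all_gf.
Proof.
have [k Ek] : exists k, (K <= m + k)%N by exists K; rewrite leq_addl.
elim: k m Ek => [|k IH] m Ek.
  have Km : (K <= m)%N by rewrite -(addn0 m).
  rewrite durfee_gf_large // q_ge ?leqW // /crank_ge_gf big_geq ?leqW //.
  by rewrite mul0r !addr0.
rewrite -(IH m.+1) ?addSnnS // crank_ge_gfS // crank_gf_durfee //.
have -> : durfee_gf m = q ^+ (m + 3) * durfee_gf m.+2 + (1 - q ^+ m.+1) * durfee_gf m.+1.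
  by rewrite -durfee_gf_rec; ring.
by rewrite addnS addn2 !exprS; ring.
Qed.

Lemma crank_ge_gf_rec (m : nat) : (0 < m)%N ->
  crank_ge_gf m = q ^+ m * (all_gf - crank_ge_gf m.+1).
Proof.
case: m => // m _.
by rewrite crank_ge_gf_durfee -(durfee_crank_ge m) addrK.
Qed.

(** * The generating function of ospt *)

(** The exponent of the remainder is m + (m+1) + ... + (m+L-1). For the rank below, the steps m+1,
    m+4, m+7, ... are added instead. *)
Lemma crank_ge_gf_iter (m L : nat) : (0 < m)%N ->
  crank_ge_gf m =
  all_gf * (\sum_(0 <= n < L) (-1) ^+ n * q ^+ ('C(n.+1, 2) + m * n.+1))
  + (-1) ^+ L * q ^+ ('C(L, 2) + m * L) * crank_ge_gf (m + L).
Proof.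
move=> m0; elim: L => [|L IH].
  by rewrite big_geq // !(mulr0, mul1r, muln0, add0r, addn0).
rewrite {1}IH big_nat_recr //= crank_ge_gf_rec ?addn_gt0 ?m0 //.
have -> : ('C(L.+1, 2) + m * L.+1 = 'C(L, 2) + m * L + (m + L))%N.
  by rewrite binS bin1; lia.
by rewrite !(exprD _ _ (m + L)) addnS exprS; ring.
Qed.

Lemma rank_ge_gf_iter (m L : nat) : (0 < m)%N ->
  rank_ge_gf m =
  all_gf * (\sum_(0 <= n < L) (-1) ^+ n * q ^+ (3 * 'C(n.+1, 2) + m.+1 * n.+1))
  + (-1) ^+ L * q ^+ (3 * 'C(L, 2) + m.+1 * L) * rank_ge_gf (m + 3 * L).
Proof.
move=> m0; elim: L => [|L IH].
  by rewrite big_geq // !(mulr0, mul1r, muln0, add0r, addn0).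
rewrite {1}IH big_nat_recr //= rank_ge_gf_rec ?addn_gt0 ?m0 //.
have -> : (3 * 'C(L.+1, 2) + m.+1 * L.+1 =
           3 * 'C(L, 2) + m.+1 * L + (m + 3 * L).+1)%N.
  by rewrite binS bin1; lia.
have -> : (m + 3 * L.+1 = (m + 3 * L).+3)%N by lia.
by rewrite !(exprD _ _ (m + 3 * L).+1) [(-1) ^+ L.+1]exprS; ring.
Qed.

(** Abel summation, used to turn the first moments into sums of [crank_ge_gf] and [rank_ge_gf]. *)
Lemma sum_mulrz_tails (x : nat -> R) (n : nat) :
  \sum_(1 <= m < n) x m *~ m = \sum_(1 <= m < n) \sum_(m <= j < n) x j.
Proof.
elim: n => [|[|n] IH]; [by rewrite !big_geq | by rewrite !big_geq |].
rewrite big_nat_recr //= IH.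
rewrite [RHS]big_nat_recr //= big_nat1.
rewrite [in RHS](eq_big_nat _ _ (F2 := fun m => \sum_(m <= j < n.+1) x j + x n.+1)).
  rewrite big_split /= sumr_const_nat subn1 /= -addrA; congr (_ + _).
  by rewrite -mulrSr.
by move=> m /andP[_ mn]; rewrite big_nat_recr // ltnW.
Qed.

Lemma gf_M1plus : gf M1plus = \sum_(1 <= m < K) crank_ge_gf m.
Proof.
rewrite /crank_ge_gf -sum_mulrz_tails.
transitivity (gf (fun n => \sum_(1 <= m < K) m%:Z * crank_count m%:Z n)).
  apply: eq_gf => n nK; rewrite /M1plus [RHS](@big_cat_nat _ _ _ n.+1) //=.
  rewrite [X in _ = _ + X]big_nat_cond [X in _ = _ + X]big1 ?addr0 // => m.
  rewrite andbT => /andP[nm _]; have [->|n0] := posnP n; last first.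
    by rewrite crank_count_gt ?mulr0.
  (* For n = 0, outside the scope of [crank_count_gt], the only partition is the empty one, of crank
     0. *)
  rewrite /crank_count /= (card_partitions _ (fun l => crank l == m%:Z)).
  rewrite (eq_in_count (a2 := pred0)) ?count_pred0 ?mulr0 // => -[|b l].
    by rewrite /crank /largest_part big_nil; case: m nm.
  by rewrite mem_partition_seq is_partition_cons leqn0 => /and4P[]; case: b.
by rewrite gf_sum; apply: eq_bigr => m _; rewrite gfM.
Qed.

Lemma rank_ge_gf_sum (m : nat) : (0 < m)%N ->
  rank_ge_gf m = \sum_(m <= j < K) gf (rank_count j%:Z).
Proof.
have [k Ek] : exists k, (K <= m + k)%N by exists K; rewrite leq_addl.
elim: k m Ek => [|k IH] m Ek m0; have [Km|mK] := leqP K m.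
- by rewrite big_geq // rank_ge_gf_rec // q_ge ?mul0r // leqW.
- by rewrite addn0 leqNgt mK in Ek.
- by rewrite big_geq // rank_ge_gf_rec // q_ge ?mul0r // leqW.
rewrite big_ltn // -IH ?addSnnS // -gfD; apply: eq_gf => n _.
rewrite (count_split _ (fun l => rank l == m%:Z)) PoszD addrC.
rewrite /rank_count (card_partitions _ (fun l => rank l == m%:Z)).
by congr (_%:Z + _%:Z); apply: eq_count => l; apply/idP/idP; lia.
Qed.

Lemma gf_N1plus : gf N1plus = \sum_(1 <= m < K) rank_ge_gf m.
Proof.
rewrite (eq_big_nat _ _ (F2 := fun m => \sum_(m <= j < K) gf (rank_count j%:Z))).
  rewrite -sum_mulrz_tails.
  transitivity (gf (fun n => \sum_(1 <= m < K) m%:Z * rank_count m%:Z n)).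
    apply: eq_gf => n nK; rewrite /N1plus [RHS](@big_cat_nat _ _ _ n.+1) //=.
    rewrite [X in _ = _ + X]big_nat_cond [X in _ = _ + X]big1 ?addr0 // => m.
    by rewrite andbT => /andP[nm _]; rewrite rank_count_gt ?mulr0.
  by rewrite gf_sum; apply: eq_bigr => m _; rewrite gfM.
by move=> m /andP[m0 _]; rewrite rank_ge_gf_sum.
Qed.

Lemma sum_shift_diff (f : nat -> R) (N : nat) :
  (forall m, (K <= m)%N -> f m = 0) ->
  \sum_(1 <= m < K) f m - \sum_(1 <= m < K) f (m + N)%N = \sum_(1 <= m < N.+1) f m.
Proof.
move=> f0; apply/eqP; rewrite subr_eq; apply/eqP.
have := big_addn 1 (K + N) N xpredT f; rewrite addnK add1n => <-.
rewrite -big_cat_nat ?ltnS ?(leq_add2r N 1) ?K_gt0 //=.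
rewrite [RHS](@big_cat_nat _ _ _ K) ?leq_addr ?K_gt0 //=.
rewrite [X in _ = _ + X]big_nat_cond [X in _ = _ + X]big1 ?addr0 // => m.
by rewrite andbT => /andP[/f0].
Qed.

(* Both indices start at 0: this is the term (n + 1, k) of the double sum. *)
Definition ospt_term (n k : nat) : R :=
  (-1) ^+ n * q ^+ ('C(n.+1, 2) + k.+1 * n.+1).

(** Since 2 C(n+1,2) = n(n+1), the n-th rank term at m is the n-th crank term at m + n + 1. Summing
    the differences over m therefore leaves only the first n + 1 crank terms. *)
Lemma gf_ospt : gf ospt =
  all_gf * \sum_(0 <= n < K) \sum_(0 <= k < n.+1) ospt_term n k.
Proof.
rewrite gfB gf_M1plus gf_N1plus -sumrB.
rewrite (eq_big_nat _ _ (F2 := fun m => all_gf * \sum_(0 <= n < K)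
   (-1) ^+ n * q ^+ 'C(n.+1, 2) * (q ^+ (m * n.+1) - q ^+ ((m + n.+1) * n.+1)))).
  rewrite -mulr_sumr exchange_big; congr (_ * _); apply: eq_bigr => n _ /=.
  rewrite -mulr_sumr sumrB.
  rewrite (@sum_shift_diff (fun m => q ^+ (m * n.+1))) => [|m Km]; last first.
    by rewrite q_ge // (leq_trans Km) // leq_pmulr.
  rewrite big_add1 mulr_sumr; apply: eq_bigr => k _.
  by rewrite /ospt_term exprD mulrA.
move=> m /andP[m0 _]; rewrite (crank_ge_gf_iter K m0) (rank_ge_gf_iter K m0).
rewrite (@q_ge ('C(K, 2) + m * K)) ?(@q_ge (3 * 'C(K, 2) + m.+1 * K)); try by nia.
rewrite !mulr0 !mul0r !addr0 -mulrBr -sumrB; congr (_ * _).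
apply: eq_bigr => n _; rewrite -mulrBr -mulrA; congr (_ * _).
rewrite mulrBr -!exprD; congr (_ - q ^+ _).
have -> : (3 * 'C(n.+1, 2) = 'C(n.+1, 2) + ('C(n.+1, 2)).*2)%N by lia.
by rewrite -mul2n mul_bin_left bin1 /=; lia.
Qed.

Lemma ospt_term_ge (n k : nat) : (K <= n.+1)%N || (K <= k.+1)%N -> ospt_term n k = 0.
Proof. by move=> Kl; rewrite /ospt_term q_ge ?mulr0 //; case/orP: Kl => ?; nia. Qed.

Lemma sum_pairs (f : nat -> R) (n : nat) :
  \sum_(0 <= i < 2 * n) f i = \sum_(0 <= i < n) (f (2 * i)%N + f (2 * i).+1).
Proof.
elim: n => [|n IH]; first by rewrite muln0 !big_geq.
by rewrite mulnS !add2n !big_nat_recr //= IH addrA.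
Qed.

(** Reindexing by j = n - k makes the two ranges independent. The bound 2K adds only vanishing terms
    and is even, so that both indices can be paired. *)
Lemma sum_ospt_term_diag :
  \sum_(0 <= n < K) \sum_(0 <= k < n.+1) ospt_term n k =
  \sum_(0 <= k < 2 * K) \sum_(0 <= j < 2 * K) ospt_term (k + j) k.
Proof.
transitivity (\sum_(0 <= n < K) \sum_(0 <= k < K | (k <= n)%N) ospt_term n k).
  apply: eq_big_nat => n /andP[_ nK].
  rewrite [RHS](@big_cat_nat _ _ _ n.+1) //= [X in _ = _ + X]big_nat_cond.
  rewrite [X in _ = _ + X]big1 ?addr0 => [|k]; last by case/andP=> /andP[]; lia.
  by rewrite big_nat_cond [RHS]big_nat_cond; apply: eq_bigl => k; lia.
rewrite (exchange_big_dep_nat xpredT) //= mul2n -addnn.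
rewrite [RHS](@big_cat_nat _ _ _ K) ?leq_addr //= [X in _ = _ + X]big_nat_cond.
rewrite [X in _ = _ + X]big1 ?addr0 => [|k]; last first.
  rewrite andbT => /andP[Kk _]; apply: big1 => j _.
  by rewrite ospt_term_ge // (leqW Kk) orbT.
apply: eq_big_nat => k /andP[_ kK].
transitivity (\sum_(k <= n < K + K + k) ospt_term n k).
  rewrite [RHS](@big_cat_nat _ _ _ K) //=; [|exact: ltnW|by lia].
  rewrite [X in _ = _ + X]big_nat_cond [X in _ = _ + X]big1 ?addr0 => [|n]; last first.
    by rewrite andbT => /andP[Kn _]; rewrite ospt_term_ge // leqW.
  rewrite [LHS](@big_cat_nat _ _ _ k) //=; last exact: ltnW.
  rewrite [X in X + _ = _]big_nat_cond [X in X + _ = _]big1 ?add0r => [|n]; last by lia.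
  by rewrite big_nat_cond [RHS]big_nat_cond; apply: eq_bigl => n; lia.
rewrite (big_addn 0 _ k xpredT) addnK; apply: eq_bigr => j _.
by rewrite addnC.
Qed.

(* Block (i, j) collects the terms k = 2i and k = 2i + 1 with n = 2i + 2j + 1
   and its successors, up to a telescoping correction. *)
Definition block_exp (i j : nat) : nat :=
  'C((2 * (i + j)).+1, 2) + (2 * i).+1 * (2 * (i + j)).+1.

Lemma block_exp_ge (i j : nat) : (j <= block_exp i j)%N.
Proof. by apply: leq_trans (leq_addl _ _); nia. Qed.

Definition block (i j : nat) : R :=
  q ^+ block_exp i j * (1 - q ^+ (2 * i).+1) * (1 - q ^+ (4 * i + 2 * j).+2)
  + q ^+ (block_exp i j + (2 * (i + j)).+1) * (1 - q ^+ (4 * i).+2)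
    * (1 - q ^+ (4 * i + 2 * j).+3).

Lemma sum_block (i : nat) :
  \sum_(0 <= j < K) (ospt_term (2 * i + 2 * j) (2 * i)
    + ospt_term (2 * i + (2 * j).+1) (2 * i)
    + (ospt_term ((2 * i).+1 + 2 * j) (2 * i).+1
    + ospt_term ((2 * i).+1 + (2 * j).+1) (2 * i).+1))
  = \sum_(0 <= j < K) block i j.
Proof.
(* The four terms add up to [block i j] minus [c j.+1 - c j]. The correction telescopes away: the
   two exponents in [c 0] coincide, and those in [c K] are at least K. *)
pose c j := q ^+ (block_exp i j + (2 * i).+1) - q ^+ (block_exp i j + (2 * (i + j)).+1).
apply/eqP; rewrite -subr_eq0 -sumrB; apply/eqP.
transitivity (\sum_(0 <= j < K) - (c j.+1 - c j)).
  apply: eq_bigr => j _; rewrite opprB.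
  have sgn0 n : (-1) ^+ (2 * n) = 1 :> R by rewrite exprM sqrrN !expr1n.
  have sgn1 n : (-1) ^+ (2 * n).+1 = -1 :> R by rewrite exprS sgn0 mulr1.
  rewrite /ospt_term.
  have -> : (2 * i + 2 * j = 2 * (i + j))%N by lia.
  have -> : (2 * i + (2 * j).+1 = (2 * (i + j)).+1)%N by lia.
  have -> : ((2 * i).+1 + 2 * j = (2 * (i + j)).+1)%N by lia.
  have -> : ((2 * i).+1 + (2 * j).+1 = 2 * (i + j).+1)%N by lia.
  rewrite !sgn0 !sgn1.
  have e1 : ('C((2 * (i + j)).+2, 2) + (2 * i).+1 * (2 * (i + j)).+2 =
    block_exp i j + ((2 * i).+1 + (2 * (i + j)).+1))%N.
    by rewrite /block_exp binS bin1; lia.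
  have e2 : ('C((2 * (i + j)).+2, 2) + (2 * i).+2 * (2 * (i + j)).+2 =
    block_exp i j + ((2 * i).+1 + (2 * (i + j)).+1 * 2 + 1))%N.
    by rewrite /block_exp binS bin1; lia.
  have e3 : (block_exp i j.+1 =
    block_exp i j + ((2 * i).+1 * 2 + (2 * (i + j)).+1 * 2 + 1))%N.
    rewrite /block_exp; have -> : (2 * (i + j.+1) = (2 * (i + j)).+2)%N by lia.
    by rewrite !(binS _ 1) !bin1; lia.
  have e4 : ('C((2 * (i + j).+1).+1, 2) + (2 * i).+2 * (2 * (i + j).+1).+1 =
    block_exp i j.+1 + ((2 * (i + j)).+1 + 2))%N.
    rewrite /block_exp; have -> : (2 * (i + j.+1) = 2 * (i + j).+1)%N by lia.
    by lia.
  rewrite e1 e2 e4 /c /block e3.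
  have -> : ((4 * i + 2 * j).+3 = (2 * i).+1 + (2 * (i + j)).+1 + 1)%N by lia.
  have -> : ((4 * i + 2 * j).+2 = (2 * i).+1 + (2 * (i + j)).+1)%N by lia.
  have -> : ((4 * i).+2 = (2 * i).+1 * 2)%N by lia.
  have -> : ((2 * (i + j.+1)).+1 = (2 * (i + j)).+1 + 2)%N by lia.
  rewrite -/(block_exp i j) !exprD !exprM expr1.
  by rewrite mul1r !mulN1r; ring.
have c0 : c 0 = 0 by rewrite /c addn0 subrr.
have cK : c K = 0 by rewrite /c !(q_ge (leq_trans (block_exp_ge i K) (leq_addr _ _))) subrr.
by rewrite sumrN telescope_sumr // c0 cK subrr oppr0.
Qed.

Lemma gf_ospt_block : gf ospt =
  all_gf * \sum_(0 <= i < K) \sum_(0 <= j < K) block i j.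
Proof.
rewrite gf_ospt sum_ospt_term_diag sum_pairs; congr (_ * _).
apply: eq_bigr => i _; by rewrite -sum_block !sum_pairs -big_split.
Qed.

(** * Nonnegativity *)

(** In a general ring R an element need not determine its coefficients, so only some natural-number
    expansion is required. *)
Definition nonneg (x : R) : Prop := exists f : nat -> nat, x = gf (fun n => (f n)%:Z).

Lemma nonnegD (x y : R) : nonneg x -> nonneg y -> nonneg (x + y).
Proof.
by move=> [f ->] [g ->]; exists (fun n => (f n + g n)%N); rewrite -gfD.
Qed.

Lemma nonneg0 : nonneg 0.
Proof. by exists (fun=> 0%N); rewrite /gf big1. Qed.

Lemma nonneg_sum (r : seq nat) (P : pred nat) (F : nat -> R) :
  (forall i, P i -> nonneg (F i)) -> nonneg (\sum_(i <- r | P i) F i).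
Proof. by move=> F0; apply: big_ind => //; [exact: nonneg0 | exact: nonnegD]. Qed.

Lemma nonnegXM (n : nat) (x : R) : nonneg x -> nonneg (q ^+ n * x).
Proof.
case=> f ->; exists (fun k => if n <= k then f (k - n) else 0)%N.
by rewrite -gf_shift; apply: eq_gf => k _; case: ifP.
Qed.

Lemma nonnegM (x y : R) : nonneg x -> nonneg y -> nonneg (x * y).
Proof.
case=> f -> y0; rewrite /gf mulr_suml; apply: nonneg_sum => n _.
rewrite mulrzAl; elim: (f n) => [|m IH]; first by rewrite mulr0z; exact: nonneg0.
by rewrite -addn1 PoszD mulrzDr mulr1z; apply: nonnegD => //; exact: nonnegXM.
Qed.

Lemma nonnegX (n : nat) : nonneg (q ^+ n).
Proof. by exists (fun k => (k == n) : nat); rewrite gf_delta. Qed.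

Lemma nonneg1 : nonneg 1. Proof. exact: (nonnegX 0). Qed.

Definition geom (k : nat) : R := \sum_(0 <= i < K) q ^+ (k * i).

Lemma nonneg_geom (k : nat) : nonneg (geom k).
Proof. by apply: nonneg_sum => i _; exact: nonnegX. Qed.

Lemma mul_1Bq_sum (k n : nat) :
  (1 - q ^+ k) * (\sum_(0 <= i < n) q ^+ (k * i)) = 1 - q ^+ (k * n).
Proof.
elim: n => [|n IH]; first by rewrite big_geq // muln0 expr0 subrr mulr0.
by rewrite big_nat_recr //= mulrDr IH mulnSr exprD; ring.
Qed.

Lemma mul_1Bq_geom (k : nat) : (0 < k)%N -> (1 - q ^+ k) * geom k = 1.
Proof. by move=> k0; rewrite mul_1Bq_sum q_ge ?subr0 // leq_pmull. Qed.

Lemma inv_poch_prod (L : nat) : inv_poch L = \prod_(1 <= k < L.+1) geom k.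
Proof.
elim: L => [|L IH]; first by rewrite big_geq // inv_poch0.
rewrite big_nat_recr //= -IH; apply: (@mul_1Bq_inj L).
by rewrite inv_pochS mulrCA mul_1Bq_geom ?mulr1.
Qed.

Lemma perm_cat_filter (s t : seq nat) : uniq s -> uniq t -> {subset s <= t} ->
  perm_eq t (s ++ [seq x <- t | x \notin s]).
Proof.
move=> us ut st; apply: uniq_perm => //.
  rewrite cat_uniq us filter_uniq // andbT; apply/hasPn => x.
  by rewrite mem_filter => /andP[].
by move=> x; rewrite mem_cat mem_filter; case: (boolP (x \in s)) => //= /st ->.
Qed.

(** Each 1 - q^k cancels its own factor [geom k] of [inv_poch L]. Distinctness ensures that no
    factor is used twice, and a product of geometric series remains. *)
Lemma nonneg_inv_poch (L : nat) (s : seq nat) :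
  uniq s -> {subset s <= index_iota 1 L.+1} ->
  nonneg (inv_poch L * \prod_(k <- s) (1 - q ^+ k)).
Proof.
move=> us sL; rewrite inv_poch_prod.
rewrite (perm_big _ (perm_cat_filter us (iota_uniq _ _) sL)) big_cat /=.
rewrite mulrAC -big_split /= [X in nonneg (X * _)]big_seq_cond.
rewrite [X in nonneg (X * _)]big1 => [|k]; last first.
  rewrite andbT => /sL; rewrite mem_index_iota => /andP[k0 _].
  by rewrite mulrC mul_1Bq_geom.
rewrite mul1r; apply: big_ind => [||k _]; first exact: nonneg1.
  exact: nonnegM.
exact: nonneg_geom.
Qed.

Lemma nonneg_block_term (a b : nat) : (1 < a)%N -> (1 < b)%N -> a != b ->
  nonneg ((1 - q) * all_gf * ((1 - q ^+ a) * (1 - q ^+ b))).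
Proof.
move=> a1 b1 ab; have [||] := @nonneg_inv_poch (K + a + b) [:: 1; a; b]%N.
- by rewrite /= !inE negb_or ab; lia.
- by move=> k; rewrite !inE mem_index_iota => /or3P[] /eqP ->; lia.
rewrite !big_cons big_nil inv_poch_large; last by lia.
by move=> f E; exists f; rewrite -E expr1; ring.
Qed.

Lemma nonneg_block (i j : nat) : nonneg ((1 - q) * all_gf * block i.+1 j).
Proof.
rewrite /block mulrDr -!(mulrA (q ^+ _)) !(mulrCA _ (q ^+ _)).
by apply: nonnegD; apply: nonnegXM; apply: nonneg_block_term; lia.
Qed.

(* For L >= K, q times this is the contribution of the block (0, 0). *)
Definition head_gf (L : nat) : R :=
  inv_poch L * ((1 - q) * ((1 - q ^+ 2) * (1 - q ^+ 4))).

Lemma nonneg_head_gf (L : nat) : (4 <= L)%N -> nonneg (head_gf L).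
Proof.
move=> L4; have [||] := @nonneg_inv_poch L [:: 1; 2; 4]%N => //.
  by move=> k; rewrite !inE mem_index_iota => /or3P[] /eqP ->; lia.
by move=> f; rewrite !big_cons big_nil mulr1 expr1; exists f.
Qed.

Lemma head_gfS (L : nat) : head_gf L.+1 = head_gf L + q ^+ L.+1 * head_gf L.+1.
Proof. by rewrite /head_gf -(inv_pochS L); ring. Qed.

Lemma head_gf_ge1 (L : nat) : (4 <= L)%N -> nonneg (head_gf L - 1).
Proof.
elim: L => // L IH; rewrite ltnS leq_eqVlt => /orP[/eqP <-|L4].
  have E : (1 - q ^+ 3) * head_gf 4 = 1.
    transitivity (inv_poch 0); last exact: inv_poch0.
    by rewrite -(inv_pochS 0) -(inv_pochS 1) -(inv_pochS 2) -(inv_pochS 3) /head_gf; ring.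
  have -> : head_gf 4 - 1 = q ^+ 3 * head_gf 4 by rewrite -[X in _ - X]E; ring.
  exact/nonnegXM/nonneg_head_gf.
rewrite head_gfS addrAC; apply: nonnegD; first exact: IH.
by apply: nonnegXM; apply: nonneg_head_gf; lia.
Qed.

Lemma head_gf_ge_sum (L : nat) : (4 <= L)%N ->
  nonneg (head_gf L - 1 - \sum_(5 <= k < L.+1) q ^+ k).
Proof.
elim: L => // L IH; rewrite leq_eqVlt => /orP[/eqP <-|L4].
  by rewrite big_geq // subr0; exact: head_gf_ge1.
rewrite big_nat_recr //=.
have -> : head_gf L.+1 - 1 - (\sum_(5 <= k < L.+1) q ^+ k + q ^+ L.+1) =
  (head_gf L - 1 - \sum_(5 <= k < L.+1) q ^+ k) + q ^+ L.+1 * (head_gf L.+1 - 1).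
  by rewrite {1}head_gfS; ring.
apply: nonnegD; first exact: IH.
by apply: nonnegXM; apply: head_gf_ge1; lia.
Qed.

Lemma head_gf_ge_seq (L : nat) (s : seq nat) : (4 <= L)%N ->
  uniq s -> {subset s <= index_iota 5 L.+1} ->
  nonneg (head_gf L - \sum_(k <- s) q ^+ k).
Proof.
move=> L4 us sL; have := head_gf_ge_sum L4.
rewrite (perm_big _ (perm_cat_filter us (iota_uniq _ _) sL)) big_cat /=.
set rest := \sum_(k <- [seq _ <- _ | _]) _ => h0.
have -> : head_gf L - \sum_(k <- s) q ^+ k =
  head_gf L - 1 - (\sum_(k <- s) q ^+ k + rest) + (1 + rest) by ring.
apply: nonnegD => //; apply: nonnegD; first exact: nonneg1.
by apply: nonneg_sum => k _; exact: nonnegX.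
Qed.

Definition no_ones_gf (L : nat) : R := (1 - q) * inv_poch L.

Lemma no_ones_gfS (L : nat) :
  no_ones_gf L.+1 = no_ones_gf L + q ^+ L.+1 * no_ones_gf L.+1.
Proof. by rewrite /no_ones_gf -(inv_pochS L); ring. Qed.

Lemma no_ones_gf2 : (1 - q ^+ 2) * no_ones_gf 2 = 1.
Proof.
transitivity (inv_poch 0); last exact: inv_poch0.
by rewrite -(inv_pochS 0) -(inv_pochS 1) /no_ones_gf; ring.
Qed.

Lemma no_ones_gf_diff (L : nat) :
  (1 - q) * no_ones_gf L.+2 =
  1 - q + q ^+ 2 * no_ones_gf 2
  + \sum_(3 <= k < L.+3) q ^+ (2 * k) * no_ones_gf k - q ^+ L.+3 * no_ones_gf L.+2.
Proof.
elim: L => [|L IH].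
  rewrite big_geq // addr0.
  transitivity ((1 - q) * ((1 - q ^+ 2) * no_ones_gf 2)
    + q ^+ 2 * no_ones_gf 2 - q ^+ 3 * no_ones_gf 2); first by ring.
  by rewrite no_ones_gf2 mulr1.
rewrite big_nat_recr //= addrA.
transitivity ((1 - q) * no_ones_gf L.+2
  + (1 - q) * (no_ones_gf L.+3 - no_ones_gf L.+2)); first by ring.
rewrite IH; have -> : q ^+ (2 * L.+3) = q ^+ L.+3 * q ^+ L.+3 by rewrite mul2n -addnn exprD.
have E : no_ones_gf L.+2 = no_ones_gf L.+3 - q ^+ L.+3 * no_ones_gf L.+3.
  by rewrite {1}(no_ones_gfS L.+2) addrK.
by rewrite [q ^+ L.+4]exprS E; ring.
Qed.

Lemma nonneg_no_ones_even (k c : nat) : (2 <= k)%N ->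
  nonneg ((1 - q ^+ (2 * c)) * no_ones_gf k).
Proof.
move=> k2; rewrite -mul_1Bq_sum mulrAC; apply: nonnegM; last first.
  by apply: nonneg_sum => i _; exact: nonnegX.
have [||] := @nonneg_inv_poch k [:: 1; 2]%N => //.
  by move=> i; rewrite !inE mem_index_iota => /orP[] /eqP ->; lia.
move=> f E; exists f; rewrite -E !big_cons big_nil expr1 /no_ones_gf; ring.
Qed.

(* Since 1 - q^2 divides 1 - q^(2c), the sum in [no_ones_gf_diff] stays
   nonnegative after multiplication by 1 - q^(2c), and its first term
   contains the q^(2c) needed to cancel -q^(2c). *)
Lemma even_term_ge (c : nat) : (0 < c)%N ->
  nonneg ((1 - q) * all_gf * ((1 - q) * (1 - q ^+ (2 * c))) - 1 + q).
Proof.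
case: c => // c _; have PE : all_gf = inv_poch K.+2 by rewrite inv_poch_large //; lia.
have -> : (1 - q) * all_gf * ((1 - q) * (1 - q ^+ (2 * c.+1))) - 1 + q =
  q * q ^+ (2 * c.+1) + q ^+ 2 * (\sum_(0 <= i < c) q ^+ (2 * i))
  + \sum_(3 <= k < K.+3) q ^+ (2 * k) * ((1 - q ^+ (2 * c.+1)) * no_ones_gf k).
  have -> : \sum_(3 <= k < K.+3) q ^+ (2 * k) * ((1 - q ^+ (2 * c.+1)) * no_ones_gf k)
    = (1 - q ^+ (2 * c.+1)) * \sum_(3 <= k < K.+3) q ^+ (2 * k) * no_ones_gf k.
    by rewrite mulr_sumr; apply: eq_bigr => k _; rewrite mulrCA.
  have -> : (1 - q) * all_gf * ((1 - q) * (1 - q ^+ (2 * c.+1))) =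
    (1 - q ^+ (2 * c.+1)) * ((1 - q) * no_ones_gf K.+2).
    by rewrite PE /no_ones_gf; ring.
  rewrite no_ones_gf_diff [q ^+ K.+3]q_ge ?mul0r ?subr0; last by lia.
  have E : (1 - q ^+ (2 * c.+1)) * no_ones_gf 2 =
     \sum_(0 <= i < c) q ^+ (2 * i) + q ^+ (2 * c).
    have -> : \sum_(0 <= i < c) q ^+ (2 * i) + q ^+ (2 * c) =
      \sum_(0 <= i < c.+1) q ^+ (2 * i) by rewrite big_nat_recr.
    by rewrite -mul_1Bq_sum mulrAC no_ones_gf2 mul1r.
  rewrite 2!mulrDr (mulrCA _ (q ^+ 2)) E.
  by rewrite mulnS exprD; ring.
apply: nonnegD; first apply: nonnegD.
- by rewrite -exprS; exact: nonnegX.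
- by apply: nonnegXM; apply: nonneg_sum => i _; exact: nonnegX.
rewrite big_nat_cond; apply: nonneg_sum => k /andP[/andP[k3 _] _].
by apply: nonnegXM; apply: nonneg_no_ones_even; exact: ltnW.
Qed.

Lemma first_row_term_ge (j : nat) :
  nonneg ((1 - q) * all_gf * block 0 j.+1 + q * q ^+ block_exp 0 j.+1).
Proof.
have -> : (1 - q) * all_gf * block 0 j.+1 + q * q ^+ block_exp 0 j.+1 =
  q ^+ block_exp 0 j.+1 * ((1 - q) * all_gf * ((1 - q) * (1 - q ^+ (2 * j.+2))) - 1 + q)
  + q ^+ block_exp 0 j.+1 + q ^+ (block_exp 0 j.+1 + (2 * j.+1).+1)
    * ((1 - q) * all_gf * ((1 - q ^+ 2) * (1 - q ^+ (2 * j.+1).+3))).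
  rewrite /block !muln0 !add0n expr1.
  have -> : ((2 * j.+1).+2 = 2 * j.+2)%N by lia.
  by ring.
apply: nonnegD; first apply: nonnegD.
- by apply: nonnegXM; apply: even_term_ge.
- exact: nonnegX.
by apply: nonnegXM; apply: nonneg_block_term; lia.
Qed.

Lemma nonneg_first_row :
  nonneg ((1 - q) * all_gf * \sum_(0 <= j < K) block 0 j).
Proof.
rewrite (big_ltn K_gt0) big_add1.
set L := (block_exp 0 K + 4)%N; set s := [seq block_exp 0 j.+1 | j <- index_iota 0 K.-1].
have exp_mono : {mono (fun j => block_exp 0 j.+1) : i j / (i <= j)%N}.
  apply: leq_mono => i j ij; rewrite /block_exp !add0n muln0 !mul1n.
  apply: (@leq_ltn_trans ('C((2 * j.+1).+1, 2) + (2 * i.+1).+1)).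
    by rewrite leq_add2r leq_bin2l //; lia.
  by rewrite ltn_add2l; lia.
have us : uniq s by rewrite map_inj_uniq ?iota_uniq //; exact: incn_inj.
have sL : {subset s <= index_iota 5 L.+1}.
  move=> _ /mapP[j + ->]; rewrite !mem_index_iota => /andP[_ jK].
  have le6 : (block_exp 0 1 <= block_exp 0 j.+1)%N by rewrite exp_mono.
  have : (block_exp 0 j.+1 <= block_exp 0 K.-1.+1)%N by rewrite exp_mono ltnW.
  by rewrite prednK ?K_gt0 // ltnS /L => /leq_trans->; rewrite ?leq_addr // (leq_trans _ le6).
have := head_gf_ge_seq (leq_addl _ _ : (4 <= L)%N) us sL.
rewrite big_map => h0.
have -> : (1 - q) * all_gf * (block 0 0 + \sum_(0 <= j < K.-1) block 0 j.+1) =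
  q ^+ 1 * (head_gf L - \sum_(0 <= j < K.-1) q ^+ block_exp 0 j.+1) +
  \sum_(0 <= j < K.-1) ((1 - q) * all_gf * block 0 j.+1 + q * q ^+ block_exp 0 j.+1).
  rewrite [X in _ = _ + X]big_split -mulr_sumr -[X in _ + (_ + X)]mulr_sumr expr1 mulrDr.
  have -> : (1 - q) * all_gf * block 0 0 = q * head_gf L.
    rewrite /head_gf inv_poch_large; last first.
      by rewrite /L; have := block_exp_ge 0 K; lia.
    by rewrite /block (_ : block_exp 0 0 = 1%N) // !muln0 !addn0; ring.
  by ring.
apply: nonnegD; first exact: nonnegXM.
by apply: nonneg_sum => j _; exact: first_row_term_ge.
Qed.

Lemma nonneg_gf_ospt : nonneg ((1 - q) * gf ospt).
Proof.
rewrite gf_ospt_block mulrA (big_ltn K_gt0) mulrDr.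
apply: nonnegD; first exact: nonneg_first_row.
rewrite big_add1 mulr_sumr; apply: nonneg_sum => i _.
by rewrite mulr_sumr; apply: nonneg_sum => j _; exact: nonneg_block.
Qed.

End NilpotentSeries.

Section Coefficients.

Local Open Scope ring_scope.

Lemma coef_gf (K n : nat) (f : nat -> int) : (n < K.+1)%N ->
  (polyn (gf ('qX : {poly %/ ('X^(K.+1) : {poly int})}) K.+1 f))`_n = f n.
Proof.
move=> nK.
have -> : gf ('qX : {poly %/ ('X^(K.+1) : {poly int})}) K.+1 f
          = in_qpoly ('X^(K.+1)) (\poly_(i < K.+1) f i).
  rewrite poly_def raddf_sum /gf big_mkord; apply: eq_bigr => i _.
  by rewrite -[X in X *: _]intz scaler_int raddfMz /= [in RHS]rmorphXn.
by rewrite /= mk_monic_Xn -Pdiv.RingMonic.take_poly_rmodp coef_take_poly nK coef_poly nK.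
Qed.

Lemma ospt_diff_ge0 (n : nat) : 0 <= ospt n.+1 - ospt n.
Proof.
pose x : {poly %/ ('X^(n.+2) : {poly int})} := 'qX.
have xK : x ^+ n.+2 = 0.
  rewrite /x -rmorphXn; apply: val_inj => /=.
  by rewrite mk_monic_Xn Pdiv.RingMonic.rmodpp // monicXn.
have [f] := nonneg_gf_ospt xK.
rewrite mulrBl mul1r -[x in x * _]expr1 -gf_shift // -gfB => E.
have := congr1 (fun y => (polyn y)`_n.+1) E; rewrite !coef_gf // subn1 /= => ->.
by [].
Qed.

End Coefficients.

Theorem lemma5p1 (N : nat) (hN : 1 <= N) : (ospt N <= ospt N.+1)%R.
Proof. by rewrite -subr_ge0 ospt_diff_ge0. Qed.
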